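(* Let $\alpha,\beta$ be integers with $\alpha\equiv\beta\equiv 7\pmod 9$ and $\alpha\equiv\beta\pmod{27}$. Then $|G_3|=3^{10}$, the nilpotency class of $G_3$ is $7$, $o(a)=o(b)=81$ and $o(c)=27$.
   Context: $G(\alpha,\beta)=\langle A,B\mid A^{[A,B]}=A^{\alpha},\ B^{[B,A]}=B^{\beta}\rangle$ with $[x,y]=x^{-1}y^{-1}xy$, $y^x=x^{-1}yx$, and $C=[A,B]$. The group $G(\alpha,\beta)$ is finite and nilpotent, hence the direct product of its Sylow subgroups; $G_3$ denotes its Sylow $3$-subgroup and $a,b,c$ denote the images of $A,B,C$ under the canonical projection $G(\alpha,\beta)\to G_3$. $o(x)$ is the order of $x$. *)

(* Defs.v *)
From HB Require Import structures.
From mathcomp Require Import all_boot all_order all_algebra all_fingroup all_solvable.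
Set Implicit Arguments. Unset Strict Implicit. Unset Printing Implicit Defensive.

Import GRing.Theory Num.Theory.
Local Open Scope group_scope.

Definition gexpz (gT : finGroupType) (x : gT) (z : int) : gT :=
  match z with
  | Posz n => x ^+ n
  | Negz n => x ^- n.+1
  end.

(* The defining relations of G(alpha,beta):
   A^[A,B] = A^alpha and B^[B,A] = B^beta, with [x,y] = x^-1 y^-1 x y and
   y^x = x^-1 y x; these coincide with mathcomp's [~ x, y] and y ^ x. *)
Definition Grels (gT : finGroupType) (alpha beta : int) (x y : gT) : Prop :=
  x ^ [~ x, y] = gexpz x alpha /\ y ^ [~ y, x] = gexpz y beta.

(* (a, b) generate a copy of the Sylow 3-subgroup G_3 of G(alpha,beta),
   with a, b the images of A, B.  Since G(alpha,beta) is finite nilpotent,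
   G_3 is its largest 3-quotient, i.e. the universal finite 3-group generated
   by two elements satisfying the relations. *)
Definition is_G3 (gT : finGroupType) (alpha beta : int) (a b : gT) : Prop :=
  [/\ 3.-group <<[set a; b]>>, Grels alpha beta a b &
   forall (hT : finGroupType) (x y : hT),
     3.-group <<[set x; y]>> -> Grels alpha beta x y ->
     exists f : {morphism <<[set a; b]>> >-> hT}, f a = x /\ f b = y].

(* Main.v *)
From Stdlib Require Import NArith.
Require Import Defs.
From mathcomp Require Import all_boot all_order all_algebra all_fingroup all_solvable.
From mathcomp Require Import zify ring.
Import GRing.Theory.
Local Open Scope group_scope.

(* Put c = [a, b], so that a^c = a^m, b^c = b^g and a^b = a c.  Every product
   (c^s b^r a^t) b is then again of the form c^s' b^r' a^t' with explicit
   exponents, whence <a, b> = <c><b><a>.  In a finite 3-group an induction through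
   a central subgroup of order 3 yields a^81 = b^81 = c^27 = a^27 b^27 = 1, and the
   order is at most 3^10.  Conversely the formula for the action of b on the
   cosets <c> b^j a^i defines permutations of 3^7 points which satisfy the
   relations and generate a 3-group of order at least 3^10.  By the upper bound,
   applied to a subgroup of a direct product, this group is universal. *)

(** For m = 7 mod 9 the number m^(3^k) - 1 is divisible by 3^(k+1) exactly. Divisibility bounds the
    upper central series; exactness kills a^81 and keeps the lower central series from dropping too
    fast. The relation a^27 b^27 = 1 is the obstacle: it comes from comparing the two ways of
    bringing a^i b c = a^i c b^g to normal form, and the exponents there depend on m and g modulo
    81. At i = 3 the two normal forms differ just enough to force it. That they agree for every i <
    81 once c^27 = a^81 = a^27 b^27 = 1 is granted is also what makes b^c = b^g hold for the
    permutations. One finite check thus serves both the upper and the lower bound. The order splits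
    as 3^10 = 81 * 27 * 27, for a, for b modulo <a>, and for c; the 3^7 cosets account for the first
    two factors, and c fixes the base coset. *)

(* geo m n = m + m^2 + ... + m^n, the exponent in (a c)^n = c^n a^(geo m n). *)
Fixpoint geo (m n : nat) : nat :=
  if n is n'.+1 then (m * (geo m n').+1)%N else 0%N.

(** * Arithmetic modulo powers of 3 *)

Lemma geoD m i j : geo m (i + j) = (geo m i + m ^ i * geo m j)%N.
Proof.
elim: i => [|i IHi]; first by rewrite add0n mul1n.
by rewrite addSn /= IHi expnS -mulnA -addSn mulnDr.
Qed.

(** With x = y q + r, every term of the cube except r^3 is divisible by 3q, since 3 divides q. Each
    cubing gains one factor 3 of precision. *)
Lemma expn3_mod q x : (3 %| q)%N -> (x ^ 3 = (x %% q) ^ 3 %[mod 3 * q])%N.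
Proof.
move=> /dvdnP[p ->]; rewrite {1}(divn_eq x (p * 3)).
move: (x %/ (p * 3))%N (x %% (p * 3))%N => y r.
have -> : ((y * (p * 3) + r) ^ 3 =
    (y ^ 3 * p ^ 2 * 3 + y ^ 2 * r * p * 3 + y * r ^ 2) * (3 * (p * 3)) + r ^ 3)%N.
  by ring.
by rewrite modnMDl.
Qed.

(** The residues are 1 + 2 * 9, 1 + 2 * 27 and 1 + 2 * 81, so they record the exact 3-adic valuation
    of m^(3^k) - 1. *)
Lemma exp3_9_27_mod m : (m %% 9 = 7)%N ->
  [/\ m ^ 3 %% 27 = 19, m ^ 9 %% 81 = 55 & m ^ 27 %% 243 = 163]%N.
Proof.
move=> m7.
have e3 : (m ^ 3 %% 27 = 19)%N by rewrite (@expn3_mod 9) // m7.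
have e9 : (m ^ 9 %% 81 = 55)%N by rewrite (expnM _ 3 3) (@expn3_mod 27) // e3.
by split=> //; rewrite (expnM _ 9 3) (@expn3_mod 81) // e9.
Qed.

Lemma exp_pow3_mod g k : (g %% 3 = 1)%N -> (g ^ (3 ^ k) %% 3 ^ k.+1 = 1)%N.
Proof.
move=> g1; elim: k => [|k IHk]; first by rewrite expn1.
rewrite (expnSr _ k) expnM (expnS 3 k.+1) expn3_mod; last by rewrite expnS dvdn_mulr.
by rewrite IHk exp1n modn_small // -expnS (ltn_exp2l 0).
Qed.

Lemma exp27_mod81 g : (g %% 3 = 1)%N -> (g ^ 27 %% 81 = 1)%N.
Proof. exact: (exp_pow3_mod g 3). Qed.

(** Tripling n = 3^k multiplies [geo m n] by 1 + m^n + m^(2n), which is 3 modulo 9 because m^n = 1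
    modulo 3. *)
Lemma geo_pow3 m k : (m %% 3 = 1)%N -> exists u, (geo m (3 ^ k) = 3 ^ k + 3 ^ k.+1 * u)%N.
Proof.
move=> m1; elim: k => [|k [u IHk]].
  by exists (m %/ 3)%N; rewrite /= muln1 {1}(divn_eq m 3) m1 addnC mulnC.
have [x ex] : exists x, (m ^ (3 ^ k) = 1 + 3 * x)%N.
  exists (m ^ (3 ^ k) %/ 3)%N; rewrite {1}(divn_eq (m ^ _) 3) addnC mulnC.
  by congr (_ + _)%N; rewrite -modnXm m1 exp1n.
rewrite {1}(_ : 3 ^ k.+1 = 3 ^ k + (3 ^ k + 3 ^ k))%N ?geoD; last by rewrite expnS; lia.
exists ((1 + 3 * u) * (x + x * x) + u)%N.
by rewrite IHk ex !expnS; ring.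
Qed.

Lemma geo27_mod81 m : (m %% 3 = 1)%N -> (geo m 27 %% 81 = 27)%N.
Proof. by case/(geo_pow3 _ 3) => u ->; rewrite addnC mulnC modnMDl. Qed.

Lemma geo_mul27_mod m x : (m %% 9 = 7)%N -> (geo m (27 * x) = 27 * x %[mod 81])%N.
Proof.
move=> m7; elim: x => [|x IHx]; first by rewrite muln0.
have m3 : (m %% 3 = 1)%N by lia.
by rewrite mulnS geoD -modnDm geo27_mod81 // -modnMm IHx exp27_mod81 // mul1n !modn_mod modnDmr.
Qed.

Lemma exp_mod27 g i : (g %% 3 = 1)%N -> (g ^ (i %% 27) = g ^ i %[mod 81])%N.
Proof.
move=> g1; rewrite {2}(divn_eq i 27) expnD (mulnC _ 27) expnM.
by rewrite -[RHS]modnMml -[in RHS]modnXm exp27_mod81 // exp1n modnMml mul1n.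
Qed.

Lemma geo_mod m i : (m %% 9 = 7)%N -> (geo m (i %% 81) = geo m i %[mod 81])%N.
Proof.
move=> m7; set r := (i %% 81)%N.
have -> : i = (27 * (3 * (i %/ 81)) + r)%N by rewrite mulnA mulnC -divn_eq.
have e : (geo m (27 * (3 * (i %/ 81))) %% 81 = 0)%N.
  by rewrite geo_mul27_mod // mulnA modnMr.
have e1 : (m ^ (27 * (3 * (i %/ 81))) %% 81 = 1)%N.
  by rewrite -exp_mod27 ?modnMr //; lia.
by rewrite geoD -modnDml e -modnDmr -modnMml e1 mul1n add0n modn_mod.
Qed.

(** * Normal words c^s b^r a^t *)

(* Exponents of (c^s b^r a^t) b, respectively (c^s b^r a^t) c for shift below,
   when a^c = a^m and b^c = b^g. *)
Definition step (m g : nat) (p : nat * nat * nat) :=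
  let '(s, r, t) := p in ((s + t)%N, (r.+1 * g ^ t)%N, geo m t).

Definition word (gT : finGroupType) (a b c : gT) (p : nat * nat * nat) : gT :=
  let '(s, r, t) := p in c ^+ s * b ^+ r * a ^+ t.

Lemma conjg_expX {gT : finGroupType} (x y : gT) m k :
  x ^ y = x ^+ m -> x ^ (y ^+ k) = x ^+ (m ^ k).
Proof.
move=> xy; elim: k => [|k IHk]; first by rewrite conjg1 expn0.
by rewrite expgSr conjgM IHk conjXg xy -expgM expnS.
Qed.

Lemma expg_mulR {gT : finGroupType} (a b c : gT) m i :
  a ^ c = a ^+ m -> (a * c) ^+ i = c ^+ i * a ^+ geo m i.
Proof.
move=> ac; elim: i => [|i IHi]; first by rewrite /= !expg0 mulg1.
rewrite expgSr IHi /= mulgA -(mulgA (c ^+ i)) -expgSr -mulgA (conjgC _ c).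
by rewrite mulgA -expgSr conjXg ac -expgM.
Qed.

Lemma word_step {gT : finGroupType} (a b c : gT) m g p :
  a ^ c = a ^+ m -> b ^ c = b ^+ g -> a ^ b = a * c ->
  word gT a b c p * b = word gT a b c (step m g p).
Proof.
case: p => [[s r] t] ac bc ab /=.
rewrite -mulgA (conjgC (a ^+ t)) conjXg ab (expg_mulR _ b _ _ _ ac).
rewrite !mulgA; congr (_ * _).
rewrite -(mulgA (c ^+ s)) -expgSr -mulgA (conjgC _ (c ^+ t)) conjXg.
by rewrite (conjg_expX _ _ _ _ bc) -expgM mulnC mulgA -expgD.
Qed.

Lemma word_iter_step {gT : finGroupType} (a b c : gT) m g p n :
  a ^ c = a ^+ m -> b ^ c = b ^+ g -> a ^ b = a * c ->
  word gT a b c p * b ^+ n = word gT a b c (iter n (step m g) p).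
Proof.
move=> ac bc ab; elim: n => [|n IHn]; first by rewrite mulg1.
by rewrite expgSr mulgA IHn (word_step _ _ _ m g).
Qed.

Lemma word_cover {gT : finGroupType} (a b c : gT) m g x :
  a ^ c = a ^+ m -> b ^ c = b ^+ g -> a ^ b = a * c ->
  x \in <<[set a; b]>> -> exists p, x = word gT a b c p.
Proof.
move=> ac bc ab /gen_prodgP[n [s sS ->]]; elim: n s sS => [|n IHn] s sS.
  by exists (0, 0, 0)%N; rewrite big_ord0 /= !expg0 !mulg1.
rewrite big_ord_recr /=.
have [|[[u v] w] ->] := IHn (fun i => s (widen_ord (leqnSn n) i)).
  by move=> i; apply: sS.
have /set2P[->|->] := sS ord_max.
  by exists (u, v, w.+1); rewrite /= expgSr mulgA.
by exists (step m g (u, v, w)); apply: word_step.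
Qed.

(** * Finite groups satisfying the relations with natural exponents *)

Definition relN (gT : finGroupType) (m n : nat) (a b : gT) : Prop :=
  a ^ [~ a, b] = a ^+ m /\ b ^ [~ b, a] = b ^+ n.

Lemma relN_sym (gT : finGroupType) m n (a b : gT) : relN gT m n a b -> relN gT n m b a.
Proof. by case. Qed.

(** The second relation conjugates by [b, a] = c^-1, while the normal form needs conjugation by c.
    In a finite group c^-1 normalises <b> as soon as it maps b into <b>, and then so does c. *)
Lemma conjg_inv_exp {gT : finGroupType} (b c : gT) n :
  b ^ c^-1 = b ^+ n -> exists g, b ^ c = b ^+ g.
Proof.
move=> bc; have : c^-1 \in 'N(<[b]>).
  by rewrite inE -cycleJ bc cycle_subG mem_cycle.
rewrite groupV => /normP cN; apply/cycleP; rewrite -cN.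
by rewrite memJ_conjg cycle_id.
Qed.

(** The normal form gives G = (<c><b>)<a>, so |G| divides the product of the orders of c, b and
    a. *)
Lemma relN_pgroup (gT : finGroupType) m n (a b : gT) (p : nat) :
  relN gT m n a b -> p.-elt a -> p.-elt b -> p.-elt [~ a, b] ->
  p.-group <<[set a; b]>>.
Proof.
case=> ac; rewrite -invg_comm => bc pa pb pc; have [g bc'] := conjg_inv_exp _ _ _ bc.
set c := [~ a, b] in ac bc bc' pc.
have ab : a ^ b = a * c by rewrite conjg_mulR.
have nbc : <[c]> \subset 'N(<[b]>) by rewrite cycle_subG inE -cycleJ bc' cycle_subG mem_cycle.
have sub : <<[set a; b]>> \subset <[c]> * <[b]> * <[a]>.
  apply/subsetP=> x /(word_cover _ _ _ _ _ _ ac bc' ab)[[[s r] t] ->].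
  by rewrite !mem_mulg ?mem_cycle.
have eqG : <<[set a; b]>> = (<[c]> <*> <[b]>) * <[a]>.
  apply/eqP; rewrite eqEsubset norm_joinEl // sub /=.
  have a_in : a \in <<[set a; b]>> by rewrite mem_gen ?set21.
  have b_in : b \in <<[set a; b]>> by rewrite mem_gen ?set22.
  by rewrite !mul_subG // cycle_subG // groupR.
rewrite /pgroup eqG; apply: (@pnat_dvd _ (#|<[c]> <*> <[b]>| * #[a])%N).
  by rewrite orderE mul_cardG dvdn_mulr.
rewrite pnatM; apply/andP; split=> //.
rewrite norm_joinEl //; apply: (@pnat_dvd _ (#[c] * #[b])%N).
  by rewrite !orderE mul_cardG dvdn_mulr.
by rewrite pnatM; apply/andP.
Qed.

(** Since b^27 is a power of a, the exponent of b can be taken below 27 and the quotient absorbed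
    into the exponent of a, its right neighbour in the word. *)
Lemma relN_card_le (gT : finGroupType) m n (a b : gT) :
  relN gT m n a b -> b ^+ 27 \in <[a]> ->
  (#|<<[set a; b]>>| <= #[a] * 27 * #[[~ a, b]])%N.
Proof.
case=> ac; rewrite -invg_comm => bc b27; have [g bc'] := conjg_inv_exp _ _ _ bc.
set c := [~ a, b] in ac bc bc' *.
have ab : a ^ b = a * c by rewrite conjg_mulR.
have [e eb] := cycleP _ _ b27.
pose f (p : 'I_#[c] * 'I_27 * 'I_#[a]) := word gT a b c (val p.1.1, val p.1.2, val p.2).
apply: (@leq_trans #|codom f|); last first.
  by apply: leq_trans (leq_image_card _ _) _; rewrite !card_prod !card_ord; lia.
apply/subset_leq_card/subsetP=> x /(word_cover _ _ _ _ _ _ ac bc' ab)[[[s r] t] ->].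
have c0 := order_gt0 c; have a0 := order_gt0 a.
have -> : word gT a b c (s, r, t) =
  f (Ordinal (ltn_pmod s c0), Ordinal (ltn_pmod r (isT : (0 < 27)%N)),
     Ordinal (ltn_pmod (e * (r %/ 27) + t) a0)).
  rewrite /f /= !expg_mod_order expgD expgM -eb -expgM -!mulgA; congr (_ * _).
  by rewrite mulgA -expgD addnC mulnC -divn_eq.
exact: codom_f.
Qed.

(** * Comparison of words by a finite computation *)

Definition shift (m g : nat) (p : nat * nat * nat) :=
  let '(s, r, t) := p in (s.+1, (r * g)%N, (t * m)%N).

Lemma word_shift {gT : finGroupType} (a b c : gT) m g p :
  a ^ c = a ^+ m -> b ^ c = b ^+ g ->
  word gT a b c p * c = word gT a b c (shift m g p).
Proof.
case: p => [[s r] t] ac bc /=.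
rewrite -mulgA (conjgC _ c) conjXg ac -expgM mulgA (mulnC t).
by rewrite -(mulgA (c ^+ s)) (conjgC _ c) conjXg bc -expgM mulgA -expgSr (mulnC r).
Qed.

(* Equality of the words c^s b^r a^t under c^27 = a^81 = 1 and a^27 b^27 = 1,
   a^27 being central. *)
Definition equiv_word (p q : nat * nat * nat) :=
  [/\ p.1.1 = q.1.1 %[mod 27], p.1.2 = q.1.2 %[mod 27] &
      p.2 + q.1.2 = q.2 + p.1.2 %[mod 81]]%N.

(* Binary arithmetic with the powers of g and the values of geo tabulated, so
   that the 27 possible parameter pairs can be checked by computation; the
   entry geo m t is kept in unary because it indexes the next lookup. *)
Definition table_succ (m g : N) (p : N * N * N) : N * N * N :=
  let '(t, x, f) := p in (t + 1, (x * g) mod 81, (m * (f + 1)) mod 81)%num.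

Definition table (m g : N) : seq (N * N * nat) :=
  [seq (p.1, N.to_nat p.2) | p <- traject (table_succ m g) (0, 1, 0)%num 81].

Definition stepN (tab : seq (N * N * nat)) (q : N * N * nat) : N * N * nat :=
  let '(s, r, t) := q in let '(u, x, f) := nth (0%num, 0%num, 0%N) tab t in
  ((s + u) mod 27, ((r + 1) * x) mod 81, f)%num.

Definition shiftN (m g : N) (q : N * N * nat) : N * N * nat :=
  let '(s, r, t) := q in
  ((s + 1) mod 27, (r * g) mod 81, N.to_nat ((N.of_nat t * m) mod 81))%num.

Definition equiv_wordN (p q : N * N * nat) : bool :=
  [&& N.eqb p.1.1 q.1.1, N.eqb (p.1.2 mod 27) (q.1.2 mod 27) &
      N.eqb ((N.of_nat p.2 + q.1.2) mod 81) ((N.of_nat q.2 + p.1.2) mod 81)]%num.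

(** [l] and [r] are the normal forms of a^i c b^g and a^i b c. The second test reads b^27 = a^54,
    that is a^-27. The third concerns i = 3, where the exponents of b differ by 54 modulo 81. *)
Definition checkN (m g : nat) : bool :=
  let mN := N.of_nat m in let gN := N.of_nat g in let tab := table mN gN in
  all (fun i => let p := (0%num, 0%num, i) in
    let l := iter g (stepN tab) (shiftN mN gN p) in
    let r := shiftN mN gN (stepN tab p) in
    [&& equiv_wordN l r,
        equiv_wordN (iter 27 (stepN tab) p) (0%num, 0%num, (i + 54) %% 81)%N &
        (i == 3) ==> N.eqb (l.1.2) ((r.1.2 + 54) mod 81)])
    (iota 0 81).

(* A conditional rather than ==>, whose arguments call-by-value evaluates. *)
Lemma checkN_true :
  all (fun m => if (m %% 9 != 7)%N then true else
    all (fun g => if (m * g %% 27 != 1)%N then true else checkN m g) (iota 0 81))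
    (iota 0 81).
Proof. by vm_compute. Qed.

Lemma checkN_holds m g :
  (m < 81)%N -> (g < 81)%N -> (m %% 9 = 7)%N -> (m * g %% 27 = 1)%N -> checkN m g.
Proof.
move=> m81 g81 m7 mg.
have /allP/(_ m) := checkN_true; rewrite mem_iota leq0n add0n m81 => /(_ isT).
cbv beta; rewrite m7 eqxx -[~~ true]/false; cbv iota => /allP/(_ g).
by rewrite mem_iota leq0n add0n g81 => /(_ isT); cbv beta; rewrite mg eqxx -[~~ true]/false.
Qed.

Lemma to_natD x y : N.to_nat (x + y) = (N.to_nat x + N.to_nat y)%N.
Proof. exact: N2Nat.inj_add. Qed.

Lemma to_natM x y : N.to_nat (x * y) = (N.to_nat x * N.to_nat y)%N.
Proof. exact: N2Nat.inj_mul. Qed.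

Lemma to_nat_mod x p : N.to_nat (x mod N.pos p) = (N.to_nat x %% Pos.to_nat p)%N.
Proof.
have lt_mod : (N.to_nat (x mod N.pos p) < Pos.to_nat p)%N.
  by have := N.mod_lt x (N.pos p); lia.
rewrite [in RHS](N.div_mod' x (N.pos p)) to_natD to_natM.
by rewrite -[N.to_nat (N.pos p)]/(Pos.to_nat p) mulnC modnMDl modn_small.
Qed.

Lemma to_nat_mod27_81 x : (N.to_nat (x mod 27) = N.to_nat x %% 27)%N *
  (N.to_nat (x mod 81) = N.to_nat x %% 81)%N.
Proof. by split; apply: to_nat_mod. Qed.

Lemma nth_table m g t : (t < 81)%N ->
  exists2 x, nth (0%num, 0%num, 0%N) (table (N.of_nat m) (N.of_nat g)) t =
      (N.of_nat t, x, geo m t %% 81)%N &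
    N.to_nat x = (g ^ t %% 81)%N.
Proof.
move=> t81; rewrite (nth_map (0, 1, 0)%num) ?size_traject // nth_traject //.
have [x [y [-> ey ->]]] : exists x y,
    [/\ iter t (table_succ (N.of_nat m) (N.of_nat g)) (0, 1, 0)%num = (N.of_nat t, x, y),
        N.to_nat x = g ^ t %% 81 & N.to_nat y = geo m t %% 81]%N.
  elim: t {t81} => [|t [x [y [e ex ey]]]]; first by exists 1%num, 0%num.
  rewrite iterS e /table_succ; do 2!eexists; split; first by congr (_, _, _); lia.
    by rewrite to_nat_mod27_81 to_natM ex Nat2N.id expnSr -[in RHS]modnMml.
  rewrite to_nat_mod27_81 to_natM to_natD ey Nat2N.id /=.
  by rewrite -[in LHS]modnMmr modnDml modnMmr addn1.
by exists x.
Qed.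

(** The exponent of b is kept modulo 81 because [equiv_word] couples it with the exponent of a
    modulo 81. *)
Definition reduces_to (p : nat * nat * nat) (q : N * N * nat) :=
  [/\ N.to_nat q.1.1 = p.1.1 %% 27, N.to_nat q.1.2 = p.1.2 %% 81 & q.2 = p.2 %% 81]%N.

(** Modulo 81, g^t has period 27 and [geo m t] has period 81 in t, so reducing the exponents after
    each step loses nothing. *)
Lemma reduces_step m g p q : (m %% 9 = 7)%N -> (g %% 3 = 1)%N -> reduces_to p q ->
  reduces_to (step m g p) (stepN (table (N.of_nat m) (N.of_nat g)) q).
Proof.
case: p q => [[s r] t] [[s' r'] t'] m7 g1 [/= es er et]; rewrite /stepN.
have [|x -> ex] := nth_table m g t'; first by rewrite et ltn_pmod.
split; rewrite /= ?to_nat_mod27_81 ?to_natM ?to_natD ?Nat2N.id.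
- by rewrite es et; lia.
- rewrite ex er et modnMmr -modnMml modnDml modnMml addn1.
  by rewrite -modnMmr -exp_mod27 // modn_dvdm // exp_mod27 // modnMmr.
- by rewrite et geo_mod.
Qed.

Lemma reduces_shift m g p q : reduces_to p q ->
  reduces_to (shift m g p) (shiftN (N.of_nat m) (N.of_nat g) q).
Proof.
case: p q => [[s r] t] [[s' r'] t'] [/= es er et].
split; rewrite /= ?to_nat_mod27_81 ?to_natM ?to_natD ?Nat2N.id.
- by rewrite es modnDml addn1.
- by rewrite er modnMml.
- by rewrite et modnMml.
Qed.

Lemma reduces_iter_step m g p q n : (m %% 9 = 7)%N -> (g %% 3 = 1)%N -> reduces_to p q ->
  reduces_to (iter n (step m g) p) (iter n (stepN (table (N.of_nat m) (N.of_nat g))) q).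
Proof. by move=> m7 g1 pq; elim: n => //= n IHn; apply: reduces_step. Qed.

Lemma reduces_equiv p q p' q' : reduces_to p p' -> reduces_to q q' ->
  equiv_wordN p' q' -> equiv_word p q.
Proof.
case: p q => [[s r] t] [[u v] w]; case: p' q' => [[s' r'] t'] [[u' v'] w'].
move=> [/= es er et] [/= eu ev ew] /and3P[/= /N.eqb_spec e1 /N.eqb_spec e2 /N.eqb_spec e3].
split=> /=; first by rewrite -es -eu e1.
  by move/(congr1 N.to_nat): e2; rewrite !to_nat_mod27_81 er ev /= !modn_dvdm.
move/(congr1 N.to_nat): e3; rewrite !to_nat_mod27_81 !to_natD !Nat2N.id er ev et ew.
by rewrite !modnDm.
Qed.

Lemma step_equiv m g i :
  (m < 81)%N -> (g < 81)%N -> (m %% 9 = 7)%N -> (m * g %% 27 = 1)%N -> (i < 81)%N ->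
  let l := iter g (step m g) (shift m g (0, 0, i)%N) in
  let r := shift m g (step m g (0, 0, i)%N) in
  [/\ equiv_word l r, equiv_word (iter 27 (step m g) (0, 0, i)%N) (0, 0, i + 54)%N &
      i = 3 -> (l.1.2 = r.1.2 + 54 %[mod 81])%N].
Proof.
move=> m81 g81 m7 mg i81 l r.
have /allP/(_ i) := checkN_holds m g m81 g81 m7 mg; rewrite mem_iota i81 => /(_ isT).
have g1 : (g %% 3 = 1)%N by nia.
have sim0 : reduces_to (0, 0, i)%N (0%num, 0%num, i) by split; rewrite /= ?modn_small.
have siml := reduces_iter_step _ _ _ _ g m7 g1 (reduces_shift m g _ _ sim0).
have simr := reduces_shift m g _ _ (reduces_step _ _ _ _ m7 g1 sim0).
case/and3P=> e1 e2 e3; split; first exact: reduces_equiv e1.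
  apply: reduces_equiv e2; first exact: reduces_iter_step.
  by split; rewrite //= modn_mod.
move/eqP/(implyP e3)/N.eqb_spec/(congr1 N.to_nat).
case: siml simr => _ + _ [_ + _] => -> er.
by rewrite to_nat_mod27_81 to_natD er modnDml.
Qed.

(** * Exponents of a, b and c in a finite 3-group *)

Lemma eq_expg_mod {gT : finGroupType} (x : gT) d i j :
  x ^+ d = 1 -> (i = j %[mod d])%N -> x ^+ i = x ^+ j.
Proof. by move=> xd ij; rewrite -(expg_mod i xd) ij expg_mod. Qed.

Lemma conjg_inverse_exp {gT : finGroupType} (b c : gT) n :
  b ^ c^-1 = b ^+ n -> b ^+ 81 = 1 -> c ^+ 27 = 1 -> b ^ c = b ^+ (n ^ 26 %% 81).
Proof.
move=> bc b81 c27; have -> : c = c^-1 ^+ 26.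
  by apply: (mulgI c^-1); rewrite mulVg -expgS expgVn c27 invg1.
by rewrite expg_mod //; apply: conjg_expX.
Qed.

(** As n^27 = 1 modulo 81, g = n^26 inverts n modulo 81, hence inverts m modulo 27. The congruence
    between the two exponents enters the finite check through this. *)
Lemma mul_inverse_mod m n : (n %% 9 = 7)%N -> (m = n %[mod 27])%N ->
  ((m %% 81) * (n ^ 26 %% 81) %% 27 = 1)%N.
Proof.
move=> n7 mn; rewrite -modnMm !modn_dvdm // mn modnMm -expnS.
by rewrite -(@modn_dvdm 81 _ 27) // exp27_mod81 //; lia.
Qed.

(* Normalising a^3 c b^g = a^3 b c on both sides gives b^54 a^54 = 1. *)
Lemma expa27_mul_expb27 (gT : finGroupType) m n (a b : gT) :
  (m %% 9 = 7)%N -> (n %% 9 = 7)%N -> (m = n %[mod 27])%N -> relN gT m n a b ->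
  a ^+ 81 = 1 -> b ^+ 81 = 1 -> [~ a, b] ^+ 27 = 1 -> commute (a ^+ 27) b ->
  a ^+ 27 * b ^+ 27 = 1.
Proof.
move=> m7 n7 mn [ac]; rewrite -invg_comm => bc a81 b81 c27 cab.
have ab : a ^ b = a * [~ a, b] by rewrite conjg_mulR.
have {}bc := conjg_inverse_exp _ _ _ bc b81 c27.
have mg := mul_inverse_mod m n n7 mn.
have {}ac : a ^ [~ a, b] = a ^+ (m %% 81) by rewrite expg_mod.
move: (n ^ 26)%N [~ a, b] mg bc ac c27 ab => N c mg bc ac c27 ab.
have m7' : (m %% 81 %% 9 = 7)%N by rewrite modn_dvdm.
have [] := step_equiv (m %% 81) (N %% 81) 3 (ltn_pmod m (isT : 0 < 81)%N) (ltn_pmod N (isT : 0 < 81)%N) m7' mg isT.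
have eqw : word gT a b c (0, 0, 3)%N * c * b ^+ (N %% 81) = word gT a b c (0, 0, 3)%N * b * c.
  by rewrite -!mulgA -bc -conjgC.
move: eqw; rewrite (word_shift _ _ _ _ _ _ ac bc) (word_iter_step _ _ _ _ _ _ _ ac bc ab).
rewrite (word_step _ _ _ _ _ _ ac bc ab) (word_shift _ _ _ _ _ _ ac bc).
case: (iter _ _ _) => [[s r] t]; case: (shift _ _ _) => [[s' r'] t'] eqw.
move=> [es _ et] _ /(_ erefl) er; rewrite /= in es et er.
have {}et : (t = t' + 54 %[mod 81])%N by lia.
move: eqw; rewrite /= (eq_expg_mod _ _ _ _ c27 es) (eq_expg_mod _ _ _ _ b81 er).
rewrite (eq_expg_mod _ _ _ _ a81 et) (expgD b r') (addnC t') (expgD a _ t') => eqw.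
have {eqw} e54 : b ^+ 54 * a ^+ 54 = 1.
  move: (b ^+ 54) (a ^+ 54) eqw => x y; rewrite -!mulgA => /mulgI/mulgI.
  by rewrite mulgA -[RHS]mul1g => /mulIg.
have cab27 : commute (a ^+ 27) (b ^+ 27) by apply: commuteX.
(* An element whose square and cube are trivial is trivial. *)
have x2 : (a ^+ 27 * b ^+ 27) ^+ 2 = 1.
  rewrite expgMn // -!(expgM _ 27 2) -[RHS]e54 (expgM b 27 2) (expgM a 27 2).
  by apply/commuteX2.
have x3 : (a ^+ 27 * b ^+ 27) ^+ 3 = 1.
  by rewrite expgMn // -!(expgM _ 27 3) a81 b81 mulg1.
by move: x3; rewrite expgS x2 mulg1.
Qed.

(** Conjugation by y^27 fixes x, so x^(m^27 - 1) = 1. As m^27 - 1 is 162 modulo 243, both x^162 and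
    x^243 vanish, and gcd(162, 243) = 81. *)
Lemma exp81_eq1 {gT : finGroupType} (x y : gT) m : (m %% 9 = 7)%N ->
  x ^ y = x ^+ m -> commute x (y ^+ 27) -> x ^+ (81 * 3) = 1 -> x ^+ 81 = 1.
Proof.
move=> m7 xy cxy x243; have [_ _ m27] := exp3_9_27_mod m m7.
have : x = x ^+ 163.
  have <- : x ^+ (m ^ 27) = x ^+ 163 by apply: eq_expg_mod x243 _; rewrite -m27 modn_mod.
  by rewrite -(conjg_expX _ _ _ _ xy) conjgE cxy mulKg.
rewrite (expgS x 162) -{1}[x]mulg1 => /mulgI e; apply: (mulIg (x ^+ 162)).
by rewrite -expgD x243 mul1g.
Qed.

(* Induction on the order: the conclusion holds modulo a central <z> of order 3.
   Then c^27 is central, so that a^(m^27 - 1) = 1 while a^243 = 1; and a^27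
   commutes with b, so that (a^27)^b = c^27 a^27 yields c^27 = 1. *)
Lemma relN_exponents (gT : finGroupType) m n (a b : gT) :
  (m %% 9 = 7)%N -> (n %% 9 = 7)%N -> (m = n %[mod 27])%N -> relN gT m n a b ->
  3.-group <<[set a; b]>> ->
  [/\ a ^+ 81 = 1, b ^+ 81 = 1, [~ a, b] ^+ 27 = 1 & a ^+ 27 * b ^+ 27 = 1].
Proof.
move=> m7 n7 mn; have [k] := ubnP #|<<[set a; b]>>|.
elim: k => // k IHk in gT a b *; rewrite ltnS => leGk rel pG.
set G := <<[set a; b]>>%G in leGk pG.
have aG : a \in G by rewrite mem_gen ?set21.
have bG : b \in G by rewrite mem_gen ?set22.
have [G1 | ntG] := eqsVneq G 1.
  by move: aG bG; rewrite G1 => /set1P-> /set1P->; rewrite comm1g !expg1n mulg1.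
have ntZ : 'Z(G) != 1 by rewrite center_nil_eq1 // (pgroup_nil pG).
have [_ p3 _] := pgroup_pdiv (pgroupS (center_sub _) pG) ntZ.
have [z zZ oz] := Cauchy (isT : prime 3) p3.
have zG : <[z]> <| G by rewrite sub_center_normal // cycle_subG.
have [_ nzG] := andP zG; have aN := subsetP nzG a aG; have bN := subsetP nzG b bG.
have G'E : <<[set coset <[z]> a; coset <[z]> b]>> = G / <[z]>.
  rewrite quotient_gen; last by apply/subsetP=> x /set2P[]->.
  by rewrite /quotient morphimEsub /= ?imsetU1 ?imset_set1 //; apply/subsetP=> x /set2P[]->.
have ltk : (#|<<[set coset <[z]> a; coset <[z]> b]>>| < k)%N.
  rewrite G'E; apply: leq_trans leGk; apply: ltn_quotient; last by case/andP: zG.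
  by rewrite -cardG_gt1 -orderE oz.
have rel' : relN _ m n (coset <[z]> a) (coset <[z]> b).
  case: rel => ac bc; split; rewrite -morphR // -morphJ ?groupR //.
    by rewrite ac morphX.
  by rewrite bc morphX.
have pG' : 3.-group <<[set coset <[z]> a; coset <[z]> b]>>.
  by rewrite G'E quotient_pgroup.
(* A relator that dies modulo <z> lies in <z>: it is central and its cube is trivial. *)
have centZ x : x \in 'N(<[z]>) -> coset <[z]> x = 1 ->
    x ^+ 3 = 1 /\ {in G, forall y, commute x y}.
  move=> xN /(coset_idr xN) xz; split; last first.
    move=> y yG; apply: (centP _ y yG); apply: subsetP xz.
    by rewrite cycle_subG; case/setIP: zZ.
  by apply/eqP; rewrite -order_dvdn -oz orderE (order_dvdG xz).
have [] := IHk _ _ _ ltk rel' pG'.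
rewrite -morphR // -!morphX ?groupR // -morphM ?groupX //.
move=> /centZ[] => [|a81 ca81]; first by rewrite groupX.
move=> /centZ[] => [|b81 cb81]; first by rewrite groupX.
move=> /centZ[] => [|c81 cc27]; first by rewrite groupX ?groupR.
move=> /centZ[] => [|_ cab]; first by rewrite groupM ?groupX.
have [ac bc] := rel; rewrite -invg_comm in bc.
have {}a81 : a ^+ 81 = 1.
  by apply: (exp81_eq1 _ _ _ m7 ac); [apply/commute_sym/cc27 | rewrite expgM].
have {}b81 : b ^+ 81 = 1.
  apply: (exp81_eq1 _ _ _ n7 bc); last by rewrite expgM.
  by rewrite expgVn; apply/commuteV/commute_sym/cc27.
(* a^27 is the central element a^27 b^27 times b^-27. *)
have ca : commute (a ^+ 27) b.
  rewrite -[a ^+ 27](mulgK (b ^+ 27)); apply/commute_sym/commuteM.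
    exact/commute_sym/cab.
  exact/commuteV/commuteX.
have c27 : [~ a, b] ^+ 27 = 1.
  have := expg_mulR a b [~ a, b] m 27 ac; rewrite -conjg_mulR -conjXg.
  rewrite conjgE ca mulKg (eq_expg_mod _ _ _ 27 a81); last by rewrite geo27_mod81 // -(@modn_dvdm 9 m 3) // m7.
  by rewrite -{1}[a ^+ 27]mul1g => /mulIg.
by split=> //; apply: (expa27_mul_expb27 _ m n).
Qed.

(** * Central series and the nilpotency class *)

Lemma comm_gen_sub (gT : finGroupType) (Z : {group gT}) (x a b : gT) :
  x \in 'N(Z) -> a \in 'N(Z) -> b \in 'N(Z) ->
  [~ x, a] \in Z -> [~ x, b] \in Z -> [~: [set x], <<[set a; b]>>] \subset Z.
Proof.
move=> xN aN bN xa xb.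
have abN : [set a; b] \subset 'N(Z) by apply/subsetP=> y /set2P[]->.
rewrite -quotient_cents2 ?sub1set ?gen_subG // quotient_set1 // quotient_gen //.
rewrite centsC gen_subG; apply/subsetP=> _ /morphimP[y yN yab ->].
apply/centP=> _ /set1P->; apply/commgP; rewrite -morphR //; apply/eqP/coset_id.
by rewrite -invg_comm groupV; case/set2P: yab => ->.
Qed.

Lemma ucn_comm (gT : finGroupType) (a b x : gT) (i : nat) :
  let G := <<[set a; b]>> in
  x \in G -> [~ x, a] \in 'Z_i(G) -> [~ x, b] \in 'Z_i(G) -> x \in 'Z_i.+1(G).
Proof.
move=> G xG xa xb; rewrite ucnSnR inE xG; have := ucn_normal i G; case/andP=> _ /subsetP nZ.
by apply: comm_gen_sub => //; apply: nZ => //; rewrite mem_gen ?set21 ?set22.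
Qed.

Lemma mod1_exp_sub {gT : finGroupType} (Z : {group gT}) (x : gT) d k :
  (0 < k)%N -> (k = 1 %[mod d])%N -> x ^+ d \in Z -> x^-1 * x ^+ k \in Z.
Proof.
move=> k0 + xd; move/eqP; rewrite eqn_mod_dvd // => /dvdnP[e ek].
by rewrite -(subnKC k0) ek expgS mulKg mulnC expgM groupX.
Qed.

Lemma coprime3_root {gT : finGroupType} (H : {group gT}) (x : gT) u :
  x ^+ 81 = 1 -> coprime 3 u -> x ^+ u \in H -> x \in H.
Proof.
move=> x81 u3 xu; have co : coprime #|<[x]>| u.
  have : (#|<[x]>| %| 3 ^ 4)%N by rewrite -orderE order_dvdn; apply/eqP.
  by move/coprime_dvdl; apply; rewrite coprimeXl.
by rewrite -(expgK co (cycle_id x)) groupX.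
Qed.

Lemma lcn_comm {gT : finGroupType} (G : {group gT}) (x y : gT) i :
  x \in 'L_i.+1(G) -> y \in G -> [~ x, y] \in 'L_i.+2(G).
Proof. by move=> xL yG; rewrite lcnSn mem_commg. Qed.

Section Class.

Variables (gT : finGroupType) (a b c : gT) (m : nat).
Hypothesis m7 : (m %% 9 = 7)%N.
Hypotheses (cE : c = [~ a, b]) (ac : a ^ c = a ^+ m).
Let G := <<[set a; b]>>%G.

Let aG : a \in G. Proof. by rewrite mem_gen ?set21. Qed.
Let bG : b \in G. Proof. by rewrite mem_gen ?set22. Qed.
Let cG : c \in G. Proof. by rewrite cE groupR. Qed.
Let m1 : (m %% 3 = 1)%N. Proof. by rewrite -(@modn_dvdm 9 m 3) // m7. Qed.
Let ab : a ^ b = a * c. Proof. by rewrite cE conjg_mulR. Qed.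

(** [a, c^(3^k)] = a^(m^(3^k) - 1) is a power of a^(3^(k+1)), and similarly for b. *)
Lemma ucn_c g i k : (g %% 3 = 1)%N -> b ^ c = b ^+ g ->
  a ^+ (3 ^ k.+1) \in 'Z_i(G) -> b ^+ (3 ^ k.+1) \in 'Z_i(G) ->
  c ^+ (3 ^ k) \in 'Z_i.+1(G).
Proof.
move=> g1 bc; have exp_pos x : (x %% 3 = 1 -> 0 < x ^ (3 ^ k))%N.
  by move=> x1; rewrite expn_gt0; case: x x1.
have mod1 x : (x %% 3 = 1)%N -> (x ^ (3 ^ k) = 1 %[mod 3 ^ k.+1])%N.
  by move=> x1; rewrite exp_pow3_mod // modn_small // (ltn_exp2l 0).
move=> aZ bZ; apply: ucn_comm; rewrite ?groupX // -invg_comm groupV commgEl.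
  rewrite (conjg_expX _ _ _ _ ac).
  by apply: (mod1_exp_sub _ _ (3 ^ k.+1)); rewrite ?mod1 ?exp_pos.
rewrite (conjg_expX _ _ _ _ bc).
by apply: (mod1_exp_sub _ _ (3 ^ k.+1)); rewrite ?mod1 ?exp_pos.
Qed.

(** [a^(3^k), b] = a^(-3^k) (a c)^(3^k) is a conjugate of c^(3^k) times a power of a^(3^(k+1)). *)
Lemma ucn_a i k : a ^+ (3 ^ k.+1) \in 'Z_i(G) -> c ^+ (3 ^ k) \in 'Z_i(G) ->
  a ^+ (3 ^ k) \in 'Z_i.+1(G).
Proof.
move=> aZ cZ; apply: ucn_comm; rewrite ?groupX //.
  by rewrite (_ : [~ _, a] = 1) ?group1 //; apply/eqP/commgP/commute_sym/commuteX.
rewrite commgEl conjXg ab (expg_mulR _ b _ _ _ ac).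
have [u ->] := geo_pow3 m k m1; rewrite expgD mulgA mulgA groupM //; last by rewrite expgM groupX.
rewrite -mulgA -/(conjg _ _) memJ_norm //.
have /andP[_ /subsetP->] // := ucn_normal i G.
by rewrite groupX.
Qed.

(** [a, c^(3^k)] = a^(3^(k+1) u) with u prime to 3, by the exact valuation; the order of a is a
    power of 3, so u can be removed. *)
Lemma lcn_a i k : a ^+ 81 = 1 -> (k < 3)%N -> c ^+ (3 ^ k) \in 'L_i.+1(G) ->
  a ^+ (3 ^ k.+1) \in 'L_i.+2(G).
Proof.
move=> a81 k3 cL.
have [u eu u3] : exists2 u, (m ^ (3 ^ k) = 1 + 3 ^ k.+1 * u)%N & coprime 3 u.
  have [e3 e9 _] := exp3_9_27_mod m m7.
  exists (m ^ (3 ^ k) %/ 3 ^ k.+1)%N.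
    by rewrite {1}(divn_eq (m ^ _) (3 ^ k.+1)) exp_pow3_mod // addnC mulnC.
  rewrite prime_coprime //; move: k3 e3 e9 {cL a81}; case: k => [|[|[|]]] // _.
  - by rewrite expn1; lia.
  - by rewrite -[(3 ^ 1)%N]/3%N -[(3 ^ 2)%N]/9%N; move: (m ^ 3)%N => x; lia.
  by rewrite -[(3 ^ 2)%N]/9%N -[(3 ^ 3)%N]/27%N; move: (m ^ 9)%N => x; lia.
refine (coprime3_root _ _ u _ u3 _); first by rewrite -expgM mulnC expgM a81 expg1n.
rewrite -expgM (_ : a ^+ _ = [~ c ^+ (3 ^ k), a]^-1); first by rewrite groupV lcn_comm.
by rewrite invg_comm commgEl (conjg_expX _ _ _ _ ac) eu expgD mulKg.
Qed.

(** [a^(3^(k+1)), b] is a conjugate of c^(3^(k+1)) times a power of a^(3^(k+2)). The latter factor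
    is equally deep in the series, as [a^(3^(k+1)), c] shows. *)
Lemma lcn_c i k : a ^+ 81 = 1 -> (k < 3)%N -> c ^+ (3 ^ k) \in 'L_i.+1(G) ->
  c ^+ (3 ^ k.+1) \in 'L_i.+3(G).
Proof.
move=> a81 k3 cL; have aL := lcn_a i k a81 k3 cL.
have a3L : a ^+ (3 ^ k.+2) \in 'L_i.+3(G).
  have [u eu u3] : exists2 u, (m = 1 + 3 * u)%N & coprime 3 u.
    by exists (m %/ 3)%N; rewrite ?prime_coprime //; lia.
  refine (coprime3_root _ _ u _ u3 _); first by rewrite -expgM mulnC expgM a81 expg1n.
  have := lcn_comm _ _ c _ aL cG; rewrite commgEl conjXg ac -expgM eu mulnDl mul1n expgD mulKg.
  by rewrite -expgM (expnS 3 k.+1) mulnAC.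
have := lcn_comm _ _ b _ aL bG; rewrite commgEl conjXg ab (expg_mulR _ b _ _ _ ac).
have [u ->] := geo_pow3 m k.+1 m1; rewrite expgD !mulgA groupMr; last by rewrite expgM groupX.
rewrite -mulgA -/(conjg _ _) memJ_norm //.
have /andP[_ /subsetP->] // := lcn_normal i.+3 G.
by rewrite groupX.
Qed.

End Class.

Lemma relN_invariants (gT : finGroupType) m n (a b : gT) :
  (m %% 9 = 7)%N -> (n %% 9 = 7)%N -> (m = n %[mod 27])%N -> relN gT m n a b ->
  3.-group <<[set a; b]>> -> #|<<[set a; b]>>| = (3 ^ 10)%N ->
  [/\ nil_class <<[set a; b]>> = 7%N, #[a] = 81%N, #[b] = 81%N & #[[~ a, b]] = 27%N].
Proof.
move=> m7 n7 mn rel pG oG.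
have [a81 b81 c27 ab27] := relN_exponents _ _ _ _ _ m7 n7 mn rel pG.
have pow3 (x : gT) k : x ^+ (3 ^ k) = 1 -> exists2 j, (j <= k)%N & #[x] = (3 ^ j)%N.
  by move=> xk; apply/(dvdn_pfactor _ _ (isT : prime 3)); rewrite order_dvdn; apply/eqP.
have [i i4 oa] := pow3 a 4 a81; have [j j4 ob] := pow3 b 4 b81.
have [l l3 oc] := pow3 [~ a, b] 3 c27.
have bound (x y : gT) p q r s : relN gT r s x y -> y ^+ 27 \in <[x]> ->
    <<[set x; y]>> = <<[set a; b]>> ->
    #[x] = (3 ^ p)%N -> #[[~ x, y]] = (3 ^ q)%N -> (10 <= p + 3 + q)%N.
  move=> rxy yx eG ox oxy; rewrite -(leq_exp2l _ _ (isT : 1 < 3)%N) -oG -eG.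
  by rewrite !expnD -ox -oxy; apply: relN_card_le rxy yx.
have b27 : b ^+ 27 = (a ^+ 27)^-1 by apply/eqP; rewrite eq_sym eq_invg_mul ab27.
have le1 : (10 <= i + 3 + l)%N.
  by apply: (bound a b _ _ m n) => //; rewrite b27 groupV mem_cycle.
have le2 : (10 <= j + 3 + l)%N.
  apply: (bound b a _ _ n m) => //; first exact: relN_sym.
  - by rewrite -[a ^+ 27]invgK -b27 groupV mem_cycle.
  - by rewrite setUC.
  by rewrite -invg_comm orderV.
(* The bounds i, j <= 4 and l <= 3 leave no slack. *)
have [ei ej el] : [/\ i = 4, j = 4 & l = 3]%N by split; lia.
rewrite oa ob oc ei ej el; split=> //.
have [ac bc] := rel; rewrite -invg_comm in bc.
have {}bc := conjg_inverse_exp _ _ _ bc b81 c27.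
have g1 : (n ^ 26 %% 81 %% 3 = 1)%N.
  by rewrite modn_dvdm // -modnXm -(@modn_dvdm 9 n 3) // n7 exp1n.
have nG := pgroup_nil pG.
have aZ1 : a ^+ 27 \in 'Z_1(<<[set a; b]>>).
  apply: ucn_comm; rewrite ?groupX ?mem_gen ?set21 // (_ : [~ _, _] = 1) ?group1 //;
    apply/eqP/commgP; first exact/commute_sym/commuteX.
  have -> : a ^+ 27 = (b ^+ 27)^-1 by rewrite b27 invgK.
  exact/commute_sym/commuteV/commuteX.
have bZ1 : b ^+ 27 \in 'Z_1(<<[set a; b]>>) by rewrite b27 groupV.

(* Passing from 3^(k+1)-th to 3^k-th powers costs two terms of the series: one for c^(3^k), one more
   for a and b. *)
have up i0 k : a ^+ (3 ^ k.+1) \in 'Z_i0(<<[set a; b]>>) ->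
    b ^+ (3 ^ k.+1) \in 'Z_i0(<<[set a; b]>>) ->
    a ^+ (3 ^ k) \in 'Z_i0.+2(<<[set a; b]>>) /\ b ^+ (3 ^ k) \in 'Z_i0.+2(<<[set a; b]>>).
  move=> aZ bZ; have subZ := subsetP (ucn_subS i0 <<[set a; b]>>).
  have cZ := ucn_c _ _ _ _ _ m7 erefl ac _ _ _ g1 bc aZ bZ.
  split; first by apply: (ucn_a _ _ _ _ _ m7 erefl ac _ _ _ cZ); apply: subZ.
  (* For b the generators are exchanged, and the commutator becomes c^-1. *)
  have := ucn_a _ _ _ _ _ n7 erefl rel.2 i0.+1 k; rewrite /= setUC; apply; first exact: subZ.
  by rewrite -invg_comm expgVn groupV.
have [aZ3 bZ3] := up 1%N 2%N aZ1 bZ1; have [aZ5 bZ5] := up 3%N 1%N aZ3 bZ3.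
have [aZ7 bZ7] := up 5%N 0%N aZ5 bZ5.
apply/eqP; rewrite eqn_leq; apply/andP; split.
  apply/(ucn_nil_classP _ nG)/eqP; rewrite eqEsubset ucn_sub gen_subG.
  by apply/subsetP=> x /set2P[]->.
(* The elements c, c^3, c^9, a^27 lie in the terms 2, 4, 6, 7 of the lower central series, and a^27
   is nontrivial since a has order 81. *)
rewrite ltnNge; apply/negP=> /(lcn_nil_classP _ nG) L7.
have c2 : [~ a, b] ^+ (3 ^ 0) \in 'L_2(<<[set a; b]>>).
  by rewrite expg1 lcnSn mem_commg ?lcn1 // mem_gen ?set21 ?set22.
have low i0 k := lcn_c _ _ _ _ _ m7 erefl ac i0 k a81.
have := lcn_a _ _ _ _ _ m7 erefl ac 5 2 a81 isT (low 3%N 1%N isT (low 1%N 0%N isT c2)).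
rewrite L7 => /set1P/eqP; rewrite -order_dvdn oa ei.
by rewrite dvdn_Pexp2l.
Qed.

(** * The permutation model on cosets of <c> *)

Lemma eq_modD d i i' j j' : (i = i' %[mod d] -> j = j' %[mod d] ->
  i + j = i' + j' %[mod d])%N.
Proof. by move=> ei ej; rewrite -modnDm ei ej modnDm. Qed.

Lemma eq_modM d i i' j j' : (i = i' %[mod d] -> j = j' %[mod d] ->
  i * j = i' * j' %[mod d])%N.
Proof. by move=> ei ej; rewrite -modnMm ei ej modnMm. Qed.

(* (j, i) stands for the coset <c> b^j a^i, where (j + 27, i + 27) ~ (j, i). *)
Definition point := ('Z_27 * 'Z_81)%type.

(** The difference i - j is unchanged when 27 is added to both; storing it in place of i makes the
    quotient a plain product. *)
Definition to_point (p : nat * nat) : point := (p.1%:R, p.2%:R - p.1%:R)%R.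

Lemma eq_to_point p q :
  to_point p = to_point q <->
  (p.1 = q.1 %[mod 27] /\ p.2 + q.1 = q.2 + p.1 %[mod 81])%N.
Proof.
have natZ d (d1 : (1 < d)%N) i j : (i%:R = j%:R :> 'Z_d)%R <-> (i = j %[mod d])%N.
  by split=> [/(congr1 val)|ij]; [|apply: val_inj]; rewrite /= !val_Zp_nat.
split=> [e | [/natZ e1 /natZ e2]].
  have e1 : (p.1%:R = q.1%:R :> 'Z_27)%R := congr1 fst e.
  have e2 : (p.2%:R - p.1%:R = q.2%:R - q.1%:R :> 'Z_81)%R := congr1 snd e.
  split; first exact/natZ.
  apply/natZ => //; rewrite !natrD -[(p.2%:R)%R](subrK (p.1%:R)%R) e2.
  by rewrite addrAC subrK.
congr (_, _); first exact: e1.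
move/(_ isT): e2; rewrite !natrD => e2; apply: (addIr (p.1%:R + q.1%:R)%R).
by rewrite addrA subrK e2 [in RHS](addrC p.1%:R%R) addrA subrK.
Qed.

Definition of_point (x : point) : nat * nat :=
  (val x.1, val (x.2 + (val x.1)%:R : 'Z_81)%R).

Lemma of_pointK x : to_point (of_point x) = x.
Proof.
case: x => u v; congr (_, _); first exact: natr_Zp.
by rewrite -[RHS](addrK ((val u)%:R)%R); congr (_ - _)%R; apply: natr_Zp.
Qed.

Lemma of_point_lt x : ((of_point x).2 < 81)%N.
Proof. exact: (ltn_ord (x.2 + (val x.1)%:R)%R). Qed.

Definition respects (F : nat * nat -> nat * nat) :=
  forall p q, to_point p = to_point q -> to_point (F p) = to_point (F q).

Definition lift_map (F : nat * nat -> nat * nat) (x : point) := to_point (F (of_point x)).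

Lemma lift_mapE F p : respects F -> lift_map F (to_point p) = to_point (F p).
Proof. by apply; rewrite of_pointK. Qed.

Lemma iter_lift_map F n p : respects F ->
  iter n (lift_map F) (to_point p) = to_point (iter n F p).
Proof. by move=> rF; elim: n => //= n ->; rewrite lift_mapE. Qed.

Lemma lift_map_inj F n : respects F ->
  (forall p, to_point (iter n.+1 F p) = to_point p) -> injective (lift_map F).
Proof.
move=> rF Fn; apply: (can_inj (g := iter n (lift_map F))) => x.
by rewrite -iterSr -[x in LHS]of_pointK iter_lift_map // Fn of_pointK.
Qed.

Section Model.

Variables m g : nat.
Hypotheses (m81 : (m < 81)%N) (g81 : (g < 81)%N) (m7 : (m %% 9 = 7)%N).
Hypothesis mg : (m * g %% 27 = 1)%N.

Let m1 : (m %% 3 = 1)%N. Proof. by rewrite -(@modn_dvdm 9 m 3) // m7. Qed.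
Let g1 : (g %% 3 = 1)%N.
Proof. by have := @modn_dvdm 27 (m * g) 3 isT; rewrite mg -modnMml m1 mul1n. Qed.

Definition map_a (p : nat * nat) := (p.1, p.2.+1).
(** From b^j a^i b = b^(j+1) (a c)^i = b^(j+1) c^i a^(geo m i): moving c^i to the left into <c>
    raises b^(j+1) to the power g^i. *)
Definition map_b (p : nat * nat) := (p.1.+1 * g ^ p.2, geo m p.2)%N.
Definition map_c (p : nat * nat) := (p.1 * g, p.2 * m)%N.

Lemma respects_a : respects map_a.
Proof.
move=> p q /eq_to_point[e1 e2]; apply/eq_to_point; split=> //=.
by rewrite !addSn -(addn1 (p.2 + q.1)) -(addn1 (q.2 + p.1)); apply: eq_modD.
Qed.

Lemma mul27_mod81 x y : (x %% 3 = 1)%N -> (27 * y * x = 27 * y %[mod 81])%N.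
Proof.
move=> x1; rewrite {1}(divn_eq x 3) x1.
have -> : (27 * y * (x %/ 3 * 3 + 1) = (x %/ 3 * y) * 81 + 27 * y)%N by ring.
by rewrite modnMDl.
Qed.

Lemma respectsP F :
  (forall j i x i', (i' = i + 27 * x %[mod 81])%N ->
    to_point (F (j, i)) = to_point (F (j + 27 * x, i')%N)) -> respects F.
Proof.
move=> rF; have main j i j' i' : (j <= j')%N ->
    to_point (j, i) = to_point (j', i') -> to_point (F (j, i)) = to_point (F (j', i')).
  move=> jj' /eq_to_point[/= /esym/eqP]; rewrite eqn_mod_dvd // => /dvdnP[x ex] e.
  have {ex} ej : j' = (j + 27 * x)%N by rewrite mulnC -ex subnKC.
  rewrite ej; apply: rF; apply/eqP; rewrite -(eqn_modDr j) -e ej; apply/eqP.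
  by congr (_ %% _)%N; lia.
move=> [j i] [j' i'] e; case: (leqP j j') => [/main | /ltnW/main h]; first exact.
exact/esym/h/esym.
Qed.

Lemma respects_c : respects map_c.
Proof.
apply: respectsP => j i x i' ei; apply/eq_to_point; split=> /=.
  by rewrite mulnDl -mulnA mulnC (mulnC 27) addnC modnMDl.
have -> : (i * m + (j + 27 * x) * g = (i * m + j * g) + 27 * x * g)%N by ring.
transitivity ((i * m + j * g + 27 * x) %% 81)%N; first by apply/eq_modD/mul27_mod81.
apply/esym; transitivity (((i + 27 * x) * m + j * g) %% 81)%N.
  by apply/eq_modD => //; apply/eq_modM.
have -> : ((i + 27 * x) * m + j * g = (i * m + j * g) + 27 * x * m)%N by ring.
by apply/eq_modD/mul27_mod81.
Qed.

Lemma respects_b : respects map_b.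
Proof.
apply: respectsP => j i x i' ei.
have eg : (g ^ i' = g ^ i %[mod 81])%N.
  rewrite -exp_mod27 // -[in RHS]exp_mod27 //; congr (g ^ _ %% _)%N.
  by rewrite -(@modn_dvdm 81) // ei modn_dvdm // addnC mulnC modnMDl.
have egeo : (geo m i' = geo m i + 27 * x %[mod 81])%N.
  rewrite -geo_mod // ei geo_mod // addnC geoD addnC; apply: eq_modD.
    rewrite -[in RHS](mul1n (geo m i)); apply: eq_modM => //.
    by rewrite -exp_mod27 // mulnC modnMl.
  exact: geo_mul27_mod.
have g3 : (g ^ i %% 3 = 1)%N by rewrite -modnXm g1 exp1n.
have eb : ((j + 27 * x).+1 * g ^ i' = j.+1 * g ^ i + 27 * x %[mod 81])%N.
  transitivity ((j + 27 * x).+1 * g ^ i %% 81)%N; first exact: eq_modM.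
  by rewrite -addSn mulnDl; apply/eq_modD/mul27_mod81.
apply/eq_to_point; split=> /=.
  by rewrite -[RHS](@modn_dvdm 81) // eb modn_dvdm // addnC (mulnC 27) modnMDl.
transitivity ((geo m i + (j.+1 * g ^ i + 27 * x)) %% 81)%N; first exact: eq_modD.
apply/esym; transitivity ((geo m i + 27 * x + j.+1 * g ^ i) %% 81)%N; first exact: eq_modD.
by rewrite addnAC addnA.
Qed.

(* The image of the coset <c> b^j under c^s b^r a^t. *)
Definition place (j : nat) (p : nat * nat * nat) :=
  let '(s, r, t) := p in (j * g ^ s + r, t)%N.

Lemma map_b_place j p : map_b (place j p) = place j (step m g p).
Proof. by case: p => [[s r] t]; rewrite /map_b /= expnD; congr (_, _); ring. Qed.

Lemma map_c_place j p : map_c (place j p) = place j (shift m g p).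
Proof. by case: p => [[s r] t]; rewrite /map_c /= expnS; congr (_, _); ring. Qed.

Lemma iter_map_b_place j p n : iter n map_b (place j p) = place j (iter n (step m g) p).
Proof. by elim: n => //= n ->; rewrite map_b_place. Qed.

Lemma equiv_word_place j p q : equiv_word p q ->
  to_point (place j p) = to_point (place j q).
Proof.
case: p q => [[s r] t] [[s' r'] t'] [/= es er et].
have eg : (j * g ^ s = j * g ^ s' %[mod 81])%N.
  apply: eq_modM => //; rewrite -exp_mod27 // -[in RHS]exp_mod27 //.
  by congr (g ^ _ %% _)%N.
apply/eq_to_point; split=> /=.
  by apply: eq_modD er; rewrite -(@modn_dvdm 81) // eg modn_dvdm.
rewrite addnCA [in RHS]addnCA; apply: eq_modD => //; exact/esym.
Qed.

Lemma place_of_point x : of_point x = place (of_point x).1 (0, 0, (of_point x).2)%N.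
Proof. by rewrite /place muln1 addn0 -surjective_pairing. Qed.

Lemma iter_map_a n p : iter n map_a p = (p.1, p.2 + n)%N.
Proof. by elim: n => [|n IHn] /=; rewrite ?addn0 -?surjective_pairing // IHn /map_a addnS. Qed.

Lemma iter_map_c n p : iter n map_c p = (p.1 * g ^ n, p.2 * m ^ n)%N.
Proof.
elim: n => [|n IHn] /=; first by rewrite !muln1 -surjective_pairing.
by rewrite IHn /map_c /= -!mulnA -!expnSr.
Qed.

Lemma iter27_map_b p : to_point (iter 27 map_b p) = to_point (p.1, p.2 + 54)%N.
Proof.
rewrite -!(iter_lift_map _ _ _ respects_b) -[to_point p]of_pointK.
have [_ e _] := step_equiv m g _ m81 g81 m7 mg (of_point_lt (to_point p)).
rewrite iter_lift_map; last exact: respects_b.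
rewrite place_of_point iter_map_b_place (equiv_word_place _ _ _ e).
have := iter_lift_map map_a 54 p respects_a; rewrite iter_map_a => <-.
rewrite -[to_point p in RHS]of_pointK iter_lift_map; last exact: respects_a.
by rewrite iter_map_a /place muln1 addn0.
Qed.

Lemma iter81_map_a p : to_point (iter 81 map_a p) = to_point p.
Proof. by rewrite iter_map_a; apply/eq_to_point; split=> //; rewrite /= addnAC modnDr. Qed.

Lemma lift_a_inj : injective (lift_map map_a).
Proof. exact: (lift_map_inj map_a 80 respects_a iter81_map_a). Qed.

Lemma lift_b_inj : injective (lift_map map_b).
Proof.
apply: (lift_map_inj map_b 80 respects_b) => p.
(* b^27 acts as a^54, so b^81 acts as a^162, and 162 = 2 * 81. *)
rewrite (iterD 54 27) -(iter_lift_map _ 54 _ respects_b) iter27_map_b.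
rewrite (iter_lift_map _ 54 _ respects_b) (iterD 27 27) -(iter_lift_map _ 27 _ respects_b).
rewrite iter27_map_b (iter_lift_map _ 27 _ respects_b) iter27_map_b.
apply/eq_to_point; split=> //=.
by move: p.1 p.2 => j i; lia.
Qed.

Lemma iter27_map_c p : to_point (iter 27 map_c p) = to_point p.
Proof.
rewrite iter_map_c; have e x y : (x %% 3 = 1)%N -> (y * x ^ 27 = y %[mod 81])%N.
  by move=> x1; rewrite -modnMmr exp27_mod81 // muln1.
apply/eq_to_point; split=> /=; first by rewrite -(@modn_dvdm 81) // e // modn_dvdm.
by apply: eq_modD; [|apply/esym]; apply: e.
Qed.

Lemma lift_c_inj : injective (lift_map map_c).
Proof. exact: (lift_map_inj map_c 26 respects_c iter27_map_c). Qed.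

Definition perm_a : {perm point} := perm lift_a_inj.
Definition perm_b : {perm point} := perm lift_b_inj.
Definition perm_c : {perm point} := perm lift_c_inj.

Lemma perm_a_to_point n p : (perm_a ^+ n) (to_point p) = to_point (iter n map_a p).
Proof.
rewrite permX -(iter_lift_map _ _ _ respects_a).
by apply: eq_iter => x; rewrite permE.
Qed.

Lemma perm_b_to_point n p : (perm_b ^+ n) (to_point p) = to_point (iter n map_b p).
Proof.
rewrite permX -(iter_lift_map _ _ _ respects_b).
by apply: eq_iter => x; rewrite permE.
Qed.

Lemma perm_c_to_point n p : (perm_c ^+ n) (to_point p) = to_point (iter n map_c p).
Proof.
rewrite permX -(iter_lift_map _ _ _ respects_c).
by apply: eq_iter => x; rewrite permE.
Qed.

Lemma perm_to_pointP (s t : {perm point}) :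
  (forall p, s (to_point p) = t (to_point p)) -> s = t.
Proof. by move=> st; apply/permP=> x; rewrite -[x]of_pointK. Qed.

Lemma perm_a81 : perm_a ^+ 81 = 1.
Proof.
by apply: perm_to_pointP => p; rewrite perm_a_to_point iter81_map_a perm1.
Qed.

Lemma perm_b27 : perm_b ^+ 27 = perm_a ^+ 54.
Proof.
by apply: perm_to_pointP => p; rewrite perm_b_to_point perm_a_to_point iter_map_a iter27_map_b.
Qed.

Lemma perm_b81 : perm_b ^+ 81 = 1.
Proof. by rewrite (expgM perm_b 27 3) perm_b27 -expgM (expgM perm_a 81 2) perm_a81 expg1n. Qed.

Lemma perm_c27 : perm_c ^+ 27 = 1.
Proof.
by apply: perm_to_pointP => p; rewrite perm_c_to_point iter27_map_c perm1.
Qed.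

Lemma perm_c_comm : perm_c = [~ perm_a, perm_b].
Proof.
rewrite /commg /conjg; apply: (mulgI (perm_b * perm_a)).
rewrite !mulgA mulgK mulgV mul1g.
apply: perm_to_pointP => p; rewrite !permM.
have := perm_a_to_point 1; have := perm_b_to_point 1; have := perm_c_to_point 1.
rewrite !expg1 /= => Ec Eb Ea; rewrite !(Ea, Eb, Ec).
(* The identity a b = b a c holds already on unreduced pairs, by the recursion defining [geo]. *)
by congr to_point; rewrite /map_a /map_b /map_c /= expnSr mulnA (mulnC m).
Qed.

Lemma perm_a_conj : perm_a ^ perm_c = perm_a ^+ m.
Proof.
apply: (mulgI perm_c); rewrite -conjgC.
apply: perm_to_pointP => p; rewrite !permM.
have := perm_a_to_point 1; have := perm_c_to_point 1; rewrite !expg1 /= => Ec Ea.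
by rewrite Ea !Ec perm_a_to_point iter_map_a /map_c /= mulSn addnC.
Qed.

Lemma perm_b_conj : perm_b ^ perm_c = perm_b ^+ g.
Proof.
apply: (mulgI perm_c); rewrite -conjgC; apply/permP=> x; rewrite -[x]of_pointK !permM.
have := perm_b_to_point 1; have := perm_c_to_point 1; rewrite !expg1 /= => Ec Eb.
rewrite Eb !Ec perm_b_to_point place_of_point map_b_place !map_c_place iter_map_b_place.
have [e _ _] := step_equiv m g _ m81 g81 m7 mg (of_point_lt x).
exact/esym/equiv_word_place.
Qed.

Lemma order_perm_c : #[perm_c] = 27%N.
Proof.
have /(dvdn_pfactor _ _ (isT : prime 3))[j j3 oc] : (#[perm_c] %| 3 ^ 3)%N.
  by rewrite order_dvdn; apply/eqP/perm_c27.
rewrite oc; move: j3; rewrite leq_eqVlt => /predU1P[-> // | j2].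
have pc9 : perm_c ^+ 9 = 1.
  by apply/eqP; rewrite -order_dvdn oc (@dvdn_Pexp2l 3 j 2).
(* c^9 would fix (0, 1), but it sends it to (0, m^9) with m^9 = 55 modulo 81. *)
have := perm_c_to_point 9 (0, 1)%N; rewrite pc9 perm1 iter_map_c => /eq_to_point[_ /=].
by rewrite mul0n !addn0 mul1n; have [_ -> _] := exp3_9_27_mod m m7.
Qed.

(** The word c^s b^r a^t sends the base coset, which c fixes, to (r, t). So r and t are read off
    from one point, and s from the order of c. *)
Lemma card_perm_group : (3 ^ 10 <= #|<<[set perm_a; perm_b]>>|)%N.
Proof.
pose f (p : 'I_27 * 'I_27 * 'I_81) := word _ perm_a perm_b perm_c (val p.1.1, val p.1.2, val p.2).
have origin p : word _ perm_a perm_b perm_c p (to_point (0, 0)%N) = to_point (p.1.2, p.2)%N.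
  case: p => [[s r] t]; rewrite /word /= !permM perm_c_to_point iter_map_c !mul0n.
  rewrite perm_b_to_point (_ : iter r _ _ = (r, 0)%N) ?perm_a_to_point ?iter_map_a //.
  by elim: r => //= r ->; rewrite /map_b /= muln1.
have f_inj : injective f.
  move=> [[s r] t] [[s' r'] t'] e.
  have := congr1 (fun u : {perm point} => u (to_point (0, 0)%N)) e; rewrite !origin /=.
  case/eq_to_point=> /= er; have {}er : r = r' by apply: val_inj; rewrite !modn_small in er.
  rewrite er => /eqP; rewrite eqn_modDr !modn_small // => /eqP/val_inj et.
  move: e; rewrite /f /= er et => /mulIg/mulIg/eqP.
  by rewrite eq_expg_mod_order order_perm_c !modn_small // => /eqP/val_inj->.
have -> : (3 ^ 10 = #|codom f|)%N by rewrite card_codom // !card_prod !card_ord.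
apply/subset_leq_card/subsetP=> _ /codomP[p ->].
have aG : perm_a \in <<[set perm_a; perm_b]>> by rewrite mem_gen ?set21.
have bG : perm_b \in <<[set perm_a; perm_b]>> by rewrite mem_gen ?set22.
by rewrite /f /word !groupM ?groupX // perm_c_comm groupR.
Qed.

End Model.

Lemma exists_large_model m n : (m < 81)%N -> (m %% 9 = 7)%N -> (n %% 9 = 7)%N ->
  (m = n %[mod 27])%N ->
  exists (gT : finGroupType) (a b : gT),
    [/\ relN gT m n a b, 3.-group <<[set a; b]>>, a ^+ 81 = 1, b ^+ 81 = 1 &
        (3 ^ 10 <= #|<<[set a; b]>>|)%N].
Proof.
move=> m81 m7 n7 mn; pose g := (n ^ 26 %% 81)%N; have g81 : (g < 81)%N by rewrite ltn_pmod.
have mg : (m * g %% 27 = 1)%N by rewrite -[m in LHS](modn_small m81) mul_inverse_mod.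
pose b := perm_b m g m81 g81 m7 mg; pose c := perm_c m g m81 g81 m7 mg.
have cE : c = [~ perm_a, b] := perm_c_comm m g m81 g81 m7 mg.
have ac : perm_a ^ [~ perm_a, b] = perm_a ^+ m by rewrite -cE; apply: perm_a_conj.
have bc : b ^ [~ perm_a, b] = b ^+ g by rewrite -cE; apply: perm_b_conj.
have c27 : [~ perm_a, b] ^+ 27 = 1 by rewrite -cE; apply: perm_c27.
have b81 : b ^+ 81 = 1 by apply: perm_b81.
exists {perm point}, perm_a, b; have := card_perm_group m g m81 g81 m7 mg; rewrite -/b => leG.
move: (perm_a) perm_a81 b c27 b81 ac bc leG {c cE} => a a81 b c27 b81 ac bc leG.
have rel : relN _ m n a b.
  (* After conjugation by c the second relation reads b = b^(g n), and g inverts n modulo 81. *)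
  split=> //; rewrite -invg_comm; apply: (conjg_inj [~ a, b]).
  rewrite conjgKV conjXg bc -expgM -[b in LHS]expg1; apply: eq_expg_mod b81 _.
  by rewrite /g modnMml -expnSr exp27_mod81 // -(@modn_dvdm 9 n 3) // n7.
have elt3 x k : x ^+ (3 ^ k) = 1 -> 3.-elt (x : {perm point}).
  move=> xk; apply: (@pnat_dvd _ (3 ^ k)%N); first by rewrite order_dvdn; apply/eqP.
  by rewrite pnatX pnat_id.
by split=> //; apply: relN_pgroup rel (elt3 a 4 a81) (elt3 b 4 b81) (elt3 _ 3 c27).
Qed.

(** * Integer exponents and universality *)

Lemma gexpz_mod (gT : finGroupType) (x : gT) (z : int) (n d : nat) :
  x ^+ d = 1 -> (z = n%:Z %[mod d%:Z])%Z -> gexpz x z = x ^+ n.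
Proof.
move=> xd /eqP; rewrite eqz_mod_dvd => /dvdzP[q eq].
case: z eq => k eq /=.
  have : (k + `|q| * d = n + 2 * `|q| * d)%N \/ (k + 2 * `|q| * d = n + `|q| * d)%N.
    by case: q eq => q eq; [left | right]; nia.
  have xqd j : x ^+ (j * d) = 1 by rewrite mulnC expgM xd expg1n.
  by case=> /(congr1 (fun i => x ^+ i)); rewrite !expgD !xqd !mulg1.
have [j ej] : exists j, (n + k.+1 = j * d)%N.
  by exists `|q|%N; nia.
apply: (mulIg (x ^+ k.+1)); rewrite mulVg -expgD ej mulnC expgM xd expg1n //.
Qed.

Lemma Grels_relN (gT : finGroupType) (alpha beta : int) (a b : gT) :
  (alpha = 7 %[mod 9])%Z -> (beta = 7 %[mod 9])%Z -> (alpha = beta %[mod 27])%Z ->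
  Grels alpha beta a b ->
  exists m n : nat, [/\ (m %% 9 = 7)%N, (n %% 9 = 7)%N, (m = n %[mod 27])%N & relN gT m n a b].
Proof.
move=> a7 b7 ab [ra rb].
have lift (x : gT) (z : int) : exists m : nat,
    (z = m%:Z %[mod 27])%Z /\ gexpz x z = x ^+ m.
  (* The factor [#[x]] preserves the power of x, the factor 27 the residue of the exponent modulo
     27. *)
  exists `|(z %% Posz (27 * #[x]))%Z|%N.
  have d0 : (Posz (27 * #[x]) != 0)%R by have := order_gt0 x; lia.
  have ez : (z = Posz `|(z %% Posz (27 * #[x]))%Z|%N %[mod Posz (27 * #[x])])%Z.
    by rewrite gez0_abs ?modz_mod // modz_ge0.
  split.
    move/eqP: ez; rewrite eqz_mod_dvd => ez; apply/eqP; rewrite eqz_mod_dvd.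
    by apply: dvdz_trans ez; rewrite PoszM dvdz_mulr.
  apply: (gexpz_mod _ _ _ _ #[x]); first exact: expg_order.
  move/eqP: ez; rewrite eqz_mod_dvd => ez; apply/eqP; rewrite eqz_mod_dvd.
  by apply: dvdz_trans ez; rewrite PoszM dvdz_mull.
have [m [em rm]] := lift a alpha; have [n [en rn]] := lift b beta.
exists m, n; split; last by rewrite /relN -rm -rn.
- by lia.
- by lia.
by lia.
Qed.

Lemma Grels_card_le (gT : finGroupType) (alpha beta : int) (a b : gT) :
  (alpha = 7 %[mod 9])%Z -> (beta = 7 %[mod 9])%Z -> (alpha = beta %[mod 27])%Z ->
  3.-group <<[set a; b]>> -> Grels alpha beta a b -> (#|<<[set a; b]>>| <= 3 ^ 10)%N.
Proof.
move=> a7 b7 ab pG rel; have [m [n [m7 n7 mn {}rel]]] := Grels_relN _ _ _ _ _ a7 b7 ab rel.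
have [a81 _ c27 ab27] := relN_exponents _ _ _ _ _ m7 n7 mn rel pG.
have b27 : b ^+ 27 \in <[a]>.
  have -> : b ^+ 27 = (a ^+ 27)^-1 by apply/eqP; rewrite eq_sym eq_invg_mul ab27.
  by rewrite groupV mem_cycle.
apply: leq_trans (relN_card_le _ _ _ _ _ rel b27) _.
rewrite (expnD 3 7 3) (expnD 3 4 3) !leq_mul //; apply: dvdn_leq => //.
  by rewrite order_dvdn; apply/eqP.
by rewrite order_dvdn; apply/eqP.
Qed.

(* The subgroup generated by (a, x) and (b, y) is the graph of the morphism. *)
Lemma morphism_of_graph (gT hT : finGroupType) (a b : gT) (x y : hT) :
  (#|<<[set (a, x); (b, y)]>>| <= #|<<[set a; b]>>|)%N ->
  exists f : {morphism <<[set a; b]>> >-> hT}, f a = x /\ f b = y.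
Proof.
set D := <<[set (a, x); (b, y)]>> => cardD.
have fstM : {in D &, {morph (fun p : gT * hT => p.1) : p q / p * q}} by [].
pose pr1 := Morphism fstM.
have im : pr1 @* D = <<[set a; b]>>.
  by rewrite morphim_gen ?subset_gen // morphimEsub ?subset_gen //= imsetU1 imset_set1.
have inj : 'injm pr1.
  by rewrite -card_im_injm eqn_leq leq_morphim im cardD.
pose f z := (invm inj z).2.
have fM : {in <<[set a; b]>> &, {morph f : u v / u * v}}.
  by rewrite -im => u v uG vG; rewrite /f morphM.
exists (Morphism fM); split=> /=.
  by rewrite /f -[a]/(pr1 (a, x)) invmE // mem_gen ?set21.
by rewrite /f -[b]/(pr1 (b, y)) invmE // mem_gen ?set22.
Qed.

Lemma is_G3_of_card (gT : finGroupType) (alpha beta : int) (a b : gT) :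
  (alpha = 7 %[mod 9])%Z -> (beta = 7 %[mod 9])%Z -> (alpha = beta %[mod 27])%Z ->
  3.-group <<[set a; b]>> -> Grels alpha beta a b -> (3 ^ 10 <= #|<<[set a; b]>>|)%N ->
  is_G3 alpha beta a b.
Proof.
move=> a7 b7 ab pG rel leG; split=> // hT x y pH relH; apply: morphism_of_graph.
apply: leq_trans leG; apply: (Grels_card_le _ alpha beta) => //.
  apply: (@pgroupS _ _ (setX <<[set a; b]>> <<[set x; y]>>)).
    rewrite gen_subG; apply/subsetP=> _ /set2P[] ->; rewrite in_setX !mem_gen ?set21 ?set22 //.
  by rewrite /pgroup cardsX pnatM; apply/andP.
have gexpzE z (p : gT * hT) : gexpz p z = (gexpz p.1 z, gexpz p.2 z).
  have expE n : p ^+ n = (p.1 ^+ n, p.2 ^+ n).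
    by elim: n => // n IHn; rewrite !expgS IHn.
  by case: z => n; rewrite /= expE.
case: rel relH => ra rb [rx ry]; split; rewrite gexpzE /= -?ra -?rb -?rx -?ry //.
Qed.

Theorem theorem9p1 (alpha beta : int) :
  (alpha = 7 %[mod 9])%Z -> (beta = 7 %[mod 9])%Z -> (alpha = beta %[mod 27])%Z ->
  (exists (gT : finGroupType) (a b : gT), is_G3 alpha beta a b) /\
  (forall (gT : finGroupType) (a b : gT), is_G3 alpha beta a b ->
     [/\ #|<<[set a; b]>>| = (3 ^ 10)%N, nil_class <<[set a; b]>> = 7%N,
         #[a] = 81%N, #[b] = 81%N & #[[~ a, b]] = 27%N]).
Proof.
move=> a7 b7 ab.
(* Residues modulo 81 suffice for the model, whose generators have trivial 81st power. *)
have natE z : exists2 n : nat, (n < 81)%N & (z = n%:Z %[mod 81%:Z])%Z.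
  by exists `|(z %% 81)%Z|%N; lia.
have [m m81 em] := natE alpha; have [n n81 en] := natE beta.
have m7 : (m %% 9 = 7)%N by lia.
have n7 : (n %% 9 = 7)%N by lia.
have mn : (m = n %[mod 27])%N by lia.
have [hT [x [y [rel pH x81 y81 leH]]]] := exists_large_model m n m81 m7 n7 mn.
have relxy : Grels alpha beta x y.
  by case: rel => rx ry; split; rewrite ?rx ?ry; apply/esym/gexpz_mod; eassumption.
split; first by exists hT, x, y; apply: is_G3_of_card.
(* Universality maps <a, b> onto the model, which gives the lower bound on its order. *)
move=> gT a b [pG relG univ]; have [f [fa fb]] := univ hT x y pH relxy.
have cardG : #|<<[set a; b]>>| = (3 ^ 10)%N.
  apply/eqP; rewrite eqn_leq (Grels_card_le _ alpha beta) //=; apply: leq_trans leH _.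
  apply: leq_trans (leq_morphim f <<[set a; b]>>); apply: subset_leq_card.
  rewrite gen_subG; apply/subsetP=> _ /set2P[]->; rewrite -?fa -?fb mem_morphim //;
    by rewrite mem_gen ?set21 ?set22.
have [p [q [p7 q7 pq {}relG]]] := Grels_relN _ _ _ _ _ a7 b7 ab relG.
by have [] := relN_invariants _ _ _ _ _ p7 q7 pq relG pG cardG.
Qed.
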